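(* Let $R$ be a Boolean ring and let $I$ be a proper ideal of $R$. The following statements are equivalent: (1) $I$ is a weakly semiprimary ideal of $R$. (2) $I$ is a weakly prime ideal of $R$.
   Context: All rings are commutative with $1 \neq 0$. A ring $R$ is Boolean if $x^2 = x$ for every $x \in R$. An ideal $I$ is proper if $I\neq R$; $\sqrt{I}$ denotes the radical of $I$. A proper ideal $I$ of $R$ is weakly semiprimary if whenever $a,b\in R$ and $0 \neq ab \in I$, then $a \in \sqrt{I}$ or $b \in \sqrt{I}$. A proper ideal $I$ of $R$ is weakly prime if whenever $a,b\in R$ and $0\neq ab \in I$, then $a \in I$ or $b \in I$. *)

(* Defs.v *)
From mathcomp Require Import all_boot all_algebra.
From mathcomp Require Import boolp classical_sets.

Set Implicit Arguments.
Unset Strict Implicit.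
Unset Printing Implicit Defensive.

Import GRing.Theory.
Local Open Scope ring_scope.

Definition boolean_ring (R : comNzRingType) : Prop := forall x : R, x ^+ 2 = x.

(* [idealr_closed] includes the properness condition 1 \notin I.  The library
   states it for boolean predicates; going through [set R] makes it range over
   all ideals, not only those with decidable membership. *)
Definition is_proper_ideal (R : comNzRingType) (I : set R) : Prop :=
  idealr_closed [in I].

Definition radical (R : comNzRingType) (I : set R) : set R :=
  fun x => exists2 n : nat, (0 < n)%N & I (x ^+ n).

Definition weakly_semiprimary (R : comNzRingType) (I : set R) : Prop :=
  is_proper_ideal I /\
  forall a b : R, a * b <> 0 -> I (a * b) -> radical I a \/ radical I b.

Definition weakly_prime (R : comNzRingType) (I : set R) : Prop :=
  is_proper_ideal I /\
  forall a b : R, a * b <> 0 -> I (a * b) -> I a \/ I b.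

(* Main.v *)
Require Import Defs.
From mathcomp Require Import all_boot all_algebra.
From mathcomp Require Import boolp classical_sets.

(** In a Boolean ring every element is idempotent, so all its positive powers
    coincide with it.  Hence every ideal is its own radical
    ([radical_boolean]), and the two notions, which differ only in having
    the radical of [I] or [I] itself in their conclusion, become the same
    condition. *)

Lemma expr_boolean (R : comNzRingType) (x : R) (n : nat) :
  boolean_ring R -> (x ^+ n.+1)%R = x.
Proof.
move=> boolR; elim: n => [|n IHn]; first exact: GRing.expr1.
by rewrite GRing.exprS IHn -GRing.expr2 boolR.
Qed.

Lemma radical_boolean (R : comNzRingType) (I : set R) :
  boolean_ring R -> radical I = I.
Proof.
move=> boolR; apply/funext => x; apply/propext; split.
- by case=> -[//|n] _; rewrite expr_boolean.
- by move=> Ix; exists 1%N; rewrite ?GRing.expr1.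
Qed.

Theorem theorem2p11 (R : comNzRingType) (I : set R) :
  boolean_ring R -> is_proper_ideal I ->
  (weakly_semiprimary I <-> weakly_prime I).
Proof.
by move=> boolR _; rewrite /weakly_semiprimary (radical_boolean R I boolR).
Qed.
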